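(* If $p\geq 7$ is an integer, then there exists a $p$-qubit UPB of size $s$ for every integer $s$ with $$\frac{p^2+3p-30}{2}\leq s\leq 2^p-6.$$
   Context: A product state in $(\mathbb{C}^2)^{\otimes p}$ is a vector $|v_1\rangle\otimes\cdots\otimes|v_p\rangle$ with each $|v_j\rangle\in\mathbb{C}^2$. A $p$-qubit unextendible product basis (UPB) is a finite set $\mathcal{S}\subseteq(\mathbb{C}^2)^{\otimes p}$ of unit product vectors that are pairwise orthogonal, such that no nonzero product vector outside $\mathcal{S}$ is orthogonal to every element of $\mathcal{S}$. The size of a UPB is its number of elements. *)

(* Defs.v *)
From HB Require Import structures.
From mathcomp Require Import all_boot all_order all_algebra.
Set Implicit Arguments. Unset Strict Implicit. Unset Printing Implicit Defensive.
Import Order.TTheory GRing.Theory Num.Theory.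
Local Open Scope ring_scope.

(* The complex field is modelled by an arbitrary C : numClosedFieldType
   (algebraically closed field with complex conjugation Num.conj). *)

(* Computational basis of (C^2)^{⊗p}: functions 'I_p -> 'I_2. *)
Definition basis_idx (p : nat) := {ffun 'I_p -> 'I_2}.

Definition qvec (C : numClosedFieldType) (p : nat) := {ffun basis_idx p -> C}.

Definition tensor (C : numClosedFieldType) (p : nat) (v : 'I_p -> 'I_2 -> C)
  : qvec C p := [ffun x : basis_idx p => \prod_(j < p) v j (x j)].

Definition is_product (C : numClosedFieldType) (p : nat) (u : qvec C p) : Prop :=
  exists v : 'I_p -> 'I_2 -> C, u = tensor v.

Definition inner (C : numClosedFieldType) (p : nat) (u w : qvec C p) : C :=
  \sum_(x : basis_idx p) (u x)^* * w x.

Definition is_UPB (C : numClosedFieldType) (p : nat) (S : seq (qvec C p)) : Prop :=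
  [/\ uniq S,
      (forall u, u \in S -> is_product u /\ inner u u = 1),
      (forall u w, u \in S -> w \in S -> u != w -> inner u w = 0)
    & (forall w : qvec C p, is_product w -> w != 0 -> w \notin S ->
         ~ (forall u, u \in S -> inner u w = 0))].

(* Main.v *)
(* UPBs are built from finite combinatorial data. Fix pairwise non-aligned
   orthonormal bases of C^2 and describe a product vector by a word over the
   symbols (basis, bit); a set of words gives a UPB as soon as any two words
   contain opposite vectors of one basis in some column and no word z agrees
   with every word of the set somewhere. If T is a q-qubit UPB and each t in T
   has its own r-qubit UPB S_t, then the vectors t (x) x with x in S_t form a
   (q + r)-qubit UPB, so sizes on r qubits can be summed.
   For odd q, a decomposition of the complete graph on q + 1 vertices into
   perfect matchings gives size q + 1. Summing sizes on 4 or 5 qubits along it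
   gives all sizes from 6p - 18 to about 16p, and then induction on p with
   T = {|0>, |1>} gives all sizes from 6p - 18 to 2^p - 6. For p >= 9 this
   contains the required range; the five sizes left over for p = 7, 8, as well
   as the small sizes on 4 qubits, come from explicit codes found by computer
   search. *)
Require Import Defs.
From HB Require Import structures.
From mathcomp Require Import all_boot all_order all_algebra.
From mathcomp Require Import zify ring.
Import Order.TTheory GRing.Theory Num.Theory.

(** * Words, clashes and codes *)

Definition somewhere (e : rel nat) (r t : seq nat) : bool :=
  has (fun ab => e ab.1 ab.2) (zip r t).

(* The symbol a stands for the vector number odd a of the orthonormal basis
   number a./2 of C^2. *)
Definition clash : rel nat := fun a b => (a./2 == b./2) && (a != b).

(* A vector of C^2 is orthogonal to at most one symbol, so a product vector
   orthogonal to all rows yields a word z that agrees with every row in some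
   column. *)
Definition is_code (p : nat) (S : seq (seq nat)) : Prop :=
  [/\ all (fun r => size r == p) S, pairwise (somewhere clash) S
    & forall z, size z = p -> exists2 r, r \in S & ~~ somewhere eq_op z r].

Definition realizable (p s : nat) : Prop :=
  exists S, is_code p S /\ size S = s.

Lemma somewhereP (e : rel nat) (p : nat) (r t : seq nat) :
  size r = p -> size t = p ->
  reflect (exists2 j, j < p & e (nth 0 r j) (nth 0 t j)) (somewhere e r t).
Proof.
move=> sr st; apply: (iffP (has_nthP (0, 0))); rewrite size_zip sr st minnn.
  by case=> j jp; rewrite nth_zip ?sr // => ejj; exists j.
by case=> j jp ejj; exists j; rewrite // nth_zip ?sr.
Qed.

Lemma somewhere_cat (e : rel nat) (r1 r2 t1 t2 : seq nat) : size r1 = size t1 ->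
  somewhere e (r1 ++ r2) (t1 ++ t2) = somewhere e r1 t1 || somewhere e r2 t2.
Proof. by move=> s12; rewrite /somewhere zip_cat // has_cat. Qed.

Lemma clash_irr (r : seq nat) : somewhere clash r r = false.
Proof. by rewrite /somewhere; elim: r => //= a r ->; rewrite /clash !eqxx. Qed.

Lemma clash_sym (r t : seq nat) : somewhere clash r t = somewhere clash t r.
Proof.
rewrite /somewhere; elim: r t => [|a r IHr] [|b t] //=.
by rewrite IHr /clash eq_sym [a == b]eq_sym.
Qed.

Lemma code_uniq (p : nat) (S : seq (seq nat)) : is_code p S -> uniq S.
Proof. by case=> _ /(pairwise_uniq clash_irr). Qed.

Lemma code_clash (p : nat) (S : seq (seq nat)) (r t : seq nat) : is_code p S ->
  r \in S -> t \in S -> r != t -> somewhere clash r t.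
Proof.
case=> _ + _; elim: S => //= a S IHS /andP[/allP aS pS].
rewrite !inE => /orP[/eqP->|rS] /orP[/eqP->|tS]; first by rewrite eqxx.
- by move=> _; apply: aS.
- by move=> _; rewrite clash_sym; apply: aS.
- exact: IHS.
Qed.

Lemma pairwise_neq (T : eqType) (e : rel T) (s : seq T) : uniq s ->
  {in s &, forall x y, x != y -> e x y} -> pairwise e s.
Proof.
elim: s => //= a s IHs /andP[aNs us] es; rewrite IHs // ?andbT => [|x y xs ys].
  apply/allP=> x xs; apply: es; rewrite ?inE ?eqxx ?xs ?orbT //.
  by apply: contraNneq aNs => ->.
by apply: es; rewrite inE ?xs ?ys orbT.
Qed.

(** * Products of codes and sums of sizes *)

Lemma realizable_prod (q r k : nat) (ss : seq nat) :
  realizable q k -> size ss = k -> {in ss, forall s, realizable r s} ->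
  realizable (q + r) (sumn ss).
Proof.
move=> [T [codeT sT]] sss rss.
have [SS codeSS sSS] : exists2 SS, {in SS, forall S, is_code r S}
    & map size SS = ss.
  elim: ss {sss} rss => [|s ss IHs] rss; first by exists [::].
  have [|SS cSS sSS] := IHs; first by move=> x xs; apply: rss; rewrite inE xs orbT.
  have [S [cS sS]] := rss s (mem_head _ _).
  exists (S :: SS); last by rewrite /= sS sSS.
  by move=> X; rewrite inE => /orP[/eqP-> //|]; apply: cSS.
have uT := code_uniq _ _ codeT.
have sTS : size T = size SS by rewrite sT -sss -sSS size_map.
(* Rows of [T] are distinct, so [index] attaches to each row exactly one code of [SS]. *)
pose F t := nth [::] SS (index t T).
have codeF t : t \in T -> is_code r (F t).
  by move=> tT; apply/codeSS/mem_nth; rewrite -sTS index_mem.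
have mapF : map F T = SS.
  apply: (@eq_from_nth _ [::]); rewrite size_map // => i iT.
  by rewrite (nth_map [::]) // /F index_uniq.
have szT t : t \in T -> size t = q by case: codeT => /allP h _ _ /h/eqP.
have szF t x : t \in T -> x \in F t -> size x = r.
  by move=> /codeF[/allP h _ _] /h/eqP.
exists [seq t ++ x | t <- T, x <- F t]; split; last first.
  by rewrite size_allpairs_dep -sSS -mapF -map_comp.
split.
- apply/allP=> u /allpairsPdep[t [x [tT xF ->]]].
  by rewrite size_cat (szT t) ?(szF t).
- apply: pairwise_neq.
    apply: allpairs_uniq_dep => // [t tT|]; first exact/code_uniq/codeF.
    move=> _ _ /allpairsPdep[t [x [tT _ ->]]] /allpairsPdep[t' [x' [t'T _ ->]]] /=.
    move=> /eqP; rewrite eqseq_cat ?(szT t) ?(szT t') //.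
    by case/andP=> /eqP-> /eqP->.
  move=> _ _ /allpairsPdep[t [x [tT xF ->]]] /allpairsPdep[t' [x' [t'T xF' ->]]].
  rewrite somewhere_cat ?(szT t) ?(szT t') //; have [tt|ntt _] := eqVneq t t'.
    rewrite -tt in xF' *; rewrite eqseq_cat // eqxx /= => nxx.
    by apply/orP; right; apply: code_clash (codeF t tT) _ _ _.
  by apply/orP; left; apply: code_clash codeT _ _ _.
(* Some [t] avoids the prefix of [z], and some row of [F t] avoids the suffix. *)
- move=> z sz; have szq : size (take q z) = q by rewrite size_takel // sz leq_addr.
  case: codeT => _ _ /(_ (take q z) szq)[t tT tz].
  case: (codeF t tT) => _ _ /(_ (drop q z)); rewrite size_drop sz addKn.
  case=> // x xF xz; exists (t ++ x); first by apply/allpairsPdep; exists t, x.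
  rewrite -[z](cat_take_drop q) somewhere_cat; last by rewrite szq szT.
  by rewrite negb_or tz.
Qed.

Lemma realizable0 : realizable 0 1.
Proof.
exists [:: [::]]; split=> //; split=> // z _.
by exists [::]; rewrite ?inE //; case: z.
Qed.

Lemma realizable12 : realizable 1 2.
Proof.
exists [:: [:: 0]; [:: 1]]; split=> //; split=> // -[|a []] // _.
by case: a => [|a]; [exists [:: 1] | exists [:: 0]].
Qed.

Lemma realizableD (p a b : nat) :
  realizable p a -> realizable p b -> realizable p.+1 (a + b).
Proof.
move=> ra rb; rewrite -[p.+1]/(1 + p) -[b]addn0 -[a + _]/(sumn [:: a; b]).
apply: (realizable_prod _ _ _ _ realizable12) => // x.
by rewrite !inE => /orP[] /eqP->.
Qed.

Lemma realizable_full (p : nat) : realizable p (2 ^ p).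
Proof.
elim: p => [|p IHp]; first exact: realizable0.
by rewrite expnS mul2n -addnn; apply: realizableD.
Qed.

(** * Codes from perfect matchings *)

(* The row i meets the row k, for i, k < p, in the column (i + k) %% p, and the
   row p in the column (i + i) %% p: this is the standard decomposition of the
   complete graph on p + 1 vertices into p perfect matchings. *)
Definition shift_entry (p i c : nat) : nat :=
  if i == p then p.*2.+1 else
  let k := (c + (p - i)) %% p in
  if k == i then p.*2 else (minn i k).*2 + (i < k).

Lemma partnerE (p i k c : nat) : i < p -> k < p -> c < p ->
  ((c + (p - i)) %% p == k) = (c == (i + k) %% p).
Proof.
move=> ip kp cp; rewrite -{1}(modn_small kp) -(eqn_modDl i) addnC -addnA.
by rewrite subnK 1?ltnW // modnDr (modn_small cp).
Qed.

(** Since 2 is invertible modulo an odd [p], each column pairs only one row with the row [p]. *)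
Lemma double_mod_inj (p i k : nat) : odd p -> i < p -> k < p ->
  (i + i) %% p = (k + k) %% p -> i = k.
Proof.
move=> op ip kp /eqP; rewrite !addnn -!mul2n.
have ge k' i' : k' <= i' -> i' < p -> 2 * i' == 2 * k' %[mod p] -> i' = k'.
  move=> ki ip'; rewrite eqn_mod_dvd ?leq_mul2l // -mulnBr.
  rewrite Gauss_dvdr ?coprimen2 // => /dvdn_leq.
  by rewrite subn_gt0; case: ltngtP ki => // ki _ /(_ isT); lia.
by case: (leqP k i) => [ki|/ltnW ki]; [move/ge->|rewrite eq_sym; move/ge->].
Qed.

(** Edges of one matching are disjoint. Each has its own basis, numbered by its smaller end, or by
    [p] if it contains the row [p]; its two ends carry opposite bits. *)
Lemma shift_entry_inj (p i k c : nat) : odd p -> i <= p -> k <= p -> c < p ->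
  shift_entry p i c = shift_entry p k c -> i = k.
Proof.
move=> op; have p0 : 0 < p by case: p op.
rewrite /shift_entry [i <= p]leq_eqVlt [k <= p]leq_eqVlt.
have [->|_] /= := eqVneq i p; have [->|_] //= := eqVneq k p.
- move=> _ kp cp; have := ltn_pmod (c + (p - k)) p0.
  by case: ifP => _ ? ; lia.
- move=> ip _ cp; have := ltn_pmod (c + (p - i)) p0.
  by case: ifP => _ ? ; lia.
move=> ip kp cp.
have := ltn_pmod (c + (p - k)) p0; have := ltn_pmod (c + (p - i)) p0.
have := partnerE p i _ c ip _ cp; have := partnerE p k _ c kp _ cp.
set k' := (c + (p - k)) %% p; set i' := (c + (p - i)) %% p => Hk Hi i'p k'p.
have := Hk _ kp; have := Hi _ ip; have := Hk _ k'p; have := Hi _ i'p.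
rewrite !eqxx => /esym/eqP ci /esym/eqP ck.
case: eqP => [_ /esym/eqP ci'|ni _]; case: eqP => [_ /esym/eqP ck'|nk _].
- by move=> _; apply: (double_mod_inj p) => //; rewrite -ci' -ck'.
- by clear Hk Hi; lia.
- by clear Hk Hi; lia.
(* The edges have the same smaller end, and equal bits put it on the same side: either [i = k], or
   the partners coincide and then [c] determines the row. *)
move=> eik; have [|[eq1 _]] : i = k \/ i' = k' /\ true by lia.
  by [].
have := eqn_modDr k' i k p; rewrite -{1}eq1 -ci -ck eqxx => /esym/eqP.
by rewrite !modn_small.
Qed.

Lemma shift_entry_clash (p i k : nat) : odd p -> i <= p -> k <= p -> i != k ->
  exists2 c, c < p & clash (shift_entry p i c) (shift_entry p k c).
Proof.
move=> op; have p0 : 0 < p by case: p op.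
have clashS i' k' c : clash (shift_entry p i' c) (shift_entry p k' c) ->
    clash (shift_entry p k' c) (shift_entry p i' c).
  by rewrite /clash eq_sym => /andP[-> /=]; rewrite eq_sym.
wlog ik : i k / i < k.
  move=> H ip kp; case: (ltngtP i k) => // [ik|ki] _.
    by apply: H; rewrite // neq_ltn ik.
  have [||||c cp e] := H k i => //; first by rewrite neq_ltn ki.
  by exists c => //; apply: clashS.
rewrite [k <= p]leq_eqVlt => _ /orP[/eqP kp|kp] _.
  have ip : i < p by rewrite -kp.
  have cp := ltn_pmod (i + i) p0; exists ((i + i) %% p) => //.
  rewrite /shift_entry kp eqxx (ltn_eqF ip).
  by move: (partnerE p i i _ ip ip cp); rewrite eqxx => ->; rewrite /clash; lia.
have ip : i < p by apply: ltn_trans kp.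
have cp := ltn_pmod (i + k) p0; exists ((i + k) %% p) => //.
rewrite /shift_entry (ltn_eqF ip) (ltn_eqF kp).
move: (partnerE p i k _ ip kp cp) (partnerE p k i _ kp ip cp).
rewrite [k + i]addnC eqxx => /eqP ek /eqP ei; rewrite ek ei.
by rewrite (ltn_eqF ik) (gtn_eqF ik) /clash; lia.
Qed.

(* Each of the p columns of z agrees with at most one of the p + 1 rows. *)
Lemma realizable_shift (p : nat) : odd p -> realizable p p.+1.
Proof.
move=> op; pose row i := mkseq (shift_entry p i) p.
have srow i : size (row i) = p by rewrite size_mkseq.
have nrow i j : j < p -> nth 0 (row i) j = shift_entry p i j.
  exact: nth_mkseq.
exists [seq row i | i <- iota 0 p.+1]; split; last by rewrite size_map size_iota.
split.
- by apply/allP=> _ /mapP[i _ ->]; rewrite srow.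
- rewrite pairwise_map; apply: pairwise_neq; first exact: iota_uniq.
  move=> i k; rewrite !mem_iota !ltnS /= => ip kp ik.
  have [c cp cl] := shift_entry_clash p i k op ip kp ik.
  by apply/(somewhereP _ p) => //; exists c; rewrite ?nrow.
- move=> z sz; apply/hasP/negPn/negP; rewrite has_map -all_predC => /allP met.
  have [f fP] : exists f : 'I_p.+1 -> 'I_p,
      forall i, nth 0 z (f i) = shift_entry p i (f i).
    apply: (fin_all_exists (P := fun (i : 'I_p.+1) (j : 'I_p) =>
      nth 0 z j = shift_entry p i j)) => i.
    have := met i; rewrite mem_iota ltn_ord => /(_ isT) /negPn.
    case/(somewhereP _ p) => // j jp /eqP; rewrite nrow // => e.
    by exists (Ordinal jp).
  have /leq_card : injective f.
    move=> i k e; apply/val_inj.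
    apply: (shift_entry_inj p i k (f i)); rewrite ?leq_ord //.
    by rewrite -fP e fP.
  by rewrite !card_ord ltnn.
Qed.

(** * Checking explicit codes by computation *)

(** A search, column by column, for a word agreeing with every row: after each guess only the rows
    not yet met remain. *)
Fixpoint coverable (n : nat) (rows : seq (seq nat)) : bool :=
  if n is m.+1 then
    nilp rows ||
    has (fun a => coverable m [seq behead r | r <- rows & head 0 r != a])
        (undup (map (head 0) rows))
  else nilp rows.

Lemma coverableP (n : nat) (rows : seq (seq nat)) (z : seq nat) :
  all (fun r => size r == n) rows -> size z = n ->
  all (somewhere eq_op z) rows -> coverable n rows.
Proof.
elim: n rows z => [|n IHn] rows z.
  by case: z => //; case: rows => //= r rows _ _; rewrite /somewhere; case: r.
case: z => // a z sr [sz] zr; rewrite /=.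
have [//|nr] /= := boolP (nilp rows); apply/hasP.
(* A symbol absent from the column meets no row, so any symbol that occurs there does at least as
   well. *)
have [b bh bP] : exists2 b, b \in map (head 0) rows &
    {in rows, forall r, head 0 r != b -> head 0 r != a}.
  have [ah|ah] := boolP (a \in map (head 0) rows); first by exists a.
  case: rows nr ah {sr zr} => // r rows _ ah; exists (head 0 r); first exact: mem_head.
  by move=> t tr _; apply: contraNneq ah => <-; apply: map_f.
exists b; rewrite ?mem_undup //; apply: (IHn _ z) => //; apply/allP=> _ /mapP[r + ->].
  by rewrite mem_filter size_behead => /andP[_ /(allP sr)/eqP->].
rewrite mem_filter => /andP[rb rr]; have ra := bP r rr rb.
have := allP zr _ rr; have := allP sr _ rr.
case: r ra {rb rr} => // c r /= ca _; rewrite /somewhere /= => /orP[] //.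
by rewrite eq_sym (negPf ca).
Qed.

Definition code_check (p : nat) (S : seq (seq nat)) : bool :=
  [&& all (fun r => size r == p) S, pairwise (somewhere clash) S
    & ~~ coverable p S].

Lemma code_checkP (p : nat) (S : seq (seq nat)) :
  code_check p S -> realizable p (size S).
Proof.
case/and3P=> sS cS nS; exists S; split=> //; split=> // z sz.
apply/hasP; apply: contraR nS; rewrite -all_predC => zS.
by apply: (coverableP _ _ z) => //; apply: sub_all zS => r /= /negPn.
Qed.

Lemma realizable4_6 : realizable 4 6.
Proof.
apply: (code_checkP 4 [:: [:: 0; 0; 0; 0]; [:: 0; 1; 2; 2]; [:: 2; 2; 1; 3];
  [:: 1; 3; 4; 4]; [:: 3; 1; 3; 5]; [:: 3; 0; 5; 1]]).
by vm_compute.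
Qed.

Lemma realizable4_7 : realizable 4 7.
Proof.
apply: (code_checkP 4 [:: [:: 0; 0; 0; 0]; [:: 2; 2; 2; 1]; [:: 0; 1; 3; 1];
  [:: 3; 0; 4; 1]; [:: 1; 3; 5; 2]; [:: 2; 2; 1; 0]; [:: 3; 1; 2; 3]]).
by vm_compute.
Qed.

Lemma realizable4_9 : realizable 4 9.
Proof.
apply: (code_checkP 4 [:: [:: 0; 0; 0; 0]; [:: 2; 2; 1; 2]; [:: 2; 1; 2; 3];
  [:: 2; 3; 1; 2]; [:: 2; 1; 3; 3]; [:: 1; 0; 4; 3]; [:: 3; 2; 5; 1];
  [:: 3; 1; 1; 0]; [:: 1; 3; 0; 2]]).
by vm_compute.
Qed.

Lemma realizable4_10 : realizable 4 10.
Proof.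
apply: (code_checkP 4 [:: [:: 0; 0; 0; 0]; [:: 2; 0; 1; 2]; [:: 4; 1; 2; 2];
  [:: 1; 1; 3; 2]; [:: 5; 1; 2; 2]; [:: 2; 2; 1; 3]; [:: 1; 3; 4; 3];
  [:: 3; 1; 5; 3]; [:: 3; 0; 5; 1]; [:: 0; 1; 3; 2]]).
by vm_compute.
Qed.

Lemma realizable5_8 : realizable 5 8.
Proof.
apply: (code_checkP 5 [:: [:: 0; 0; 0; 0; 0]; [:: 2; 2; 2; 2; 1];
  [:: 1; 3; 4; 2; 2]; [:: 4; 3; 6; 1; 3]; [:: 3; 1; 5; 0; 4];
  [:: 6; 1; 7; 3; 5]; [:: 7; 2; 3; 1; 6]; [:: 5; 0; 1; 3; 7]]).
by vm_compute.
Qed.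

Lemma realizable5_9 : realizable 5 9.
Proof.
apply: (code_checkP 5 [:: [:: 0; 0; 0; 0; 0]; [:: 2; 2; 2; 1; 2];
  [:: 3; 2; 3; 2; 1]; [:: 3; 4; 2; 1; 4]; [:: 1; 3; 4; 4; 5];
  [:: 3; 5; 2; 5; 1]; [:: 4; 1; 5; 0; 0]; [:: 5; 1; 3; 3; 4];
  [:: 2; 0; 1; 5; 3]]).
by vm_compute.
Qed.

Lemma realizable6_8 : realizable 6 8.
Proof.
apply: (code_checkP 6 [:: [:: 0; 0; 0; 0; 0; 0]; [:: 1; 2; 2; 2; 2; 2];
  [:: 2; 1; 3; 4; 4; 4]; [:: 4; 0; 4; 3; 1; 6]; [:: 3; 3; 1; 6; 6; 7];
  [:: 5; 2; 6; 1; 3; 5]; [:: 6; 1; 7; 5; 7; 3]; [:: 7; 3; 5; 7; 5; 1]]).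
by vm_compute.
Qed.

Lemma realizable6_13 : realizable 6 13.
Proof.
apply: (code_checkP 6 [:: [:: 0; 0; 0; 0; 0; 0]; [:: 2; 2; 2; 1; 2; 2];
  [:: 1; 3; 4; 2; 4; 0]; [:: 4; 4; 0; 1; 3; 1]; [:: 5; 1; 5; 2; 3; 4];
  [:: 3; 5; 6; 3; 1; 4]; [:: 1; 4; 0; 0; 5; 5]; [:: 2; 6; 1; 3; 6; 3];
  [:: 0; 4; 4; 0; 1; 2]; [:: 4; 5; 7; 0; 7; 1]; [:: 4; 2; 1; 2; 6; 3];
  [:: 3; 4; 1; 3; 0; 4]; [:: 5; 7; 3; 1; 5; 5]]).
by vm_compute.
Qed.

(** * Intervals of realizable sizes *)

Definition sum_of (r k s : nat) : Prop := exists ss,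
  [/\ size ss = k, sumn ss = s & {in ss, forall x, realizable r x}].

Lemma sum_of1 (r s : nat) : realizable r s -> sum_of r 1 s.
Proof.
move=> rs; exists [:: s]; split=> //; first exact: addn0.
by move=> x; rewrite inE => /eqP->.
Qed.

Lemma sum_ofS (r k a s : nat) : realizable r a -> a <= s ->
  sum_of r k (s - a) -> sum_of r k.+1 s.
Proof.
move=> ra sa [ss [sss sums rss]]; exists (a :: ss).
split=> /=; rewrite ?sss ?sums ?subnKC // => x.
by rewrite inE => /orP[/eqP->//|]; apply: rss.
Qed.

Lemma realizable_sum_of (q r k s : nat) : realizable q k -> sum_of r k s ->
  realizable (q + r) s.
Proof. by move=> qk [ss [sss <- rss]]; apply: (realizable_prod q r k). Qed.

Lemma realizable4 (s : nat) : [|| 6 <= s <= 10, s == 12 | s == 16] ->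
  realizable 4 s.
Proof.
have r3 := realizable_shift 3 isT; have r38 := realizable_full 3.
have [?|?] := leqP s 5; first by lia.
have [?|?] := leqP s 16; last by lia.
have [-> _|?] := eqVneq s 6; first exact: realizable4_6.
have [-> _|?] := eqVneq s 7; first exact: realizable4_7.
have [-> _|?] := eqVneq s 8; first exact: (realizableD 3 4 4).
have [-> _|?] := eqVneq s 9; first exact: realizable4_9.
have [-> _|?] := eqVneq s 10; first exact: realizable4_10.
have [-> _|?] := eqVneq s 12; first exact: (realizableD 3 4 8).
have [-> _|?] := eqVneq s 16; first exact: (realizable_full 4).
by move=> ?; exfalso; lia.
Qed.

(** A summand among 6, 10, 12, 16 is split off, large enough to bring the rest into the interval for
    one summand fewer; so the missing sizes 11 and 13 to 15 do no harm. *)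
Lemma sum_of4 (k s : nat) : 0 < k -> 6 * k <= s -> s + 6 <= 16 * k ->
  sum_of 4 k s.
Proof.
case: k => // k _; elim: k s => [|k IHk] s lo hi.
  by apply/sum_of1/realizable4; lia.
have [a [ra sa lo' hi']] : exists a, [/\ realizable 4 a, a <= s,
    6 * k.+1 <= s - a & s - a + 6 <= 16 * k.+1].
  have [?|?] := leqP s (16 * k.+1).
    by exists 6; split; try (by apply: realizable4); lia.
  have [?|?] := leqP s (16 * k.+1 + 4).
    by exists 10; split; try (by apply: realizable4); lia.
  have [?|?] := leqP s (16 * k.+1 + 6).
    by exists 12; split; try (by apply: realizable4); lia.
  by exists 16; split; try (by apply: realizable4); lia.
by apply: (sum_ofS _ _ a) => //; apply: IHk.
Qed.

Lemma realizable5 (s : nat) : 12 <= s <= 26 -> realizable 5 s.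
Proof.
have D a b : realizable 4 a -> realizable 4 b -> a + b = s -> realizable 5 s.
  by move=> ra rb <-; apply: realizableD.
move=> hs; have [?|?] := leqP s 16.
  by apply: (D 6 (s - 6)); [apply: realizable4; lia.. | lia].
have [?|?] := leqP s 20.
  by apply: (D 10 (s - 10)); [apply: realizable4; lia.. | lia].
have [?|?] := leqP s 22.
  by apply: (D 12 (s - 12)); [apply: realizable4; lia.. | lia].
by apply: (D 16 (s - 16)); [apply: realizable4; lia.. | lia].
Qed.

(** One summand is taken in 12..26 and the others among 6, 12, 26, so the least sum is 12 + 6(k -
    1). *)
Lemma sum_of5 (k s : nat) : 0 < k -> 6 * k + 6 <= s -> s <= 26 * k ->
  sum_of 5 k s.
Proof.
case: k => // k _; elim: k s => [|k IHk] s lo hi.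
  by apply/sum_of1/realizable5; lia.
have [a [ra sa lo' hi']] : exists a, [/\ realizable 5 a, a <= s,
    6 * k.+1 + 6 <= s - a & s - a <= 26 * k.+1].
  have [?|?] := leqP s (26 * k.+1 + 6).
    by exists 6; split; try (by apply: (realizable_shift 5)); lia.
  have [?|?] := leqP s (26 * k.+1 + 12).
    by exists 12; split; try (by apply: realizable5); lia.
  by exists 26; split; try (by apply: realizable5); lia.
by apply: (sum_ofS _ _ a) => //; apply: IHk.
Qed.

(** Both parities start at 6p - 18, as 6(p - 3) or 6(p - 4) + 6. The end 12p - 49 is one less than
    twice the start for [p - 1], from which point one qubit can be split off. *)
Lemma realizable_low (p s : nat) : 8 <= p -> 6 * p <= s + 18 ->
  s + 49 <= 12 * p -> realizable p s.
Proof.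
move=> p8 lo hi; have [op|ep] := boolP (odd p).
  have -> : p = (p - 4) + 4 by lia.
  apply: (realizable_sum_of _ _ (p - 4).+1).
    by apply: realizable_shift; lia.
  by apply: sum_of4; lia.
have -> : p = (p - 5) + 5 by lia.
apply: (realizable_sum_of _ _ (p - 5).+1).
  by apply: realizable_shift; lia.
by apply: sum_of5; lia.
Qed.

Lemma realizable_range (p s : nat) : 7 <= p -> 6 * p <= s + 18 ->
  s + 6 <= 2 ^ p -> realizable p s.
Proof.
move=> p7; rewrite -(subnK p7); elim: (p - 7) s => [|n IHn] s.
  (* Four summands give 24 to 58, eight give 48 to 122 = 2^7 - 6. *)
  rewrite add0n => lo hi; have [?|?] := leqP s 58.
    apply: (realizable_sum_of 3 4 4); first exact: (realizable_shift 3).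
    by apply: sum_of4; lia.
  apply: (realizable_sum_of 3 4 8); first exact: (realizable_full 3).
  by apply: sum_of4 => //; move: hi; rewrite (_ : 2 ^ 7 = 128) //; lia.
have large : 6 * (n + 7) <= 2 ^ (n + 7).
  elim: n {IHn} => // n IHn; rewrite addSn expnS; lia.
rewrite addSn expnS; move: large IHn (realizable_full (n + 7)).
set N := 2 ^ _ => large IHn rN lo hi.
have [?|?] := leqP (s + 49) (12 * (n + 7).+1); first by apply: realizable_low; lia.
have D a : a <= s -> realizable (n + 7) a -> realizable (n + 7) (s - a) ->
    realizable (n + 7).+1 s.
  by move=> ? ra rb; rewrite -(@subnKC a s) //; apply: realizableD.
have [?|?] := leqP (N + 6 * (n + 7)) (s + 18).
  by apply: (D N) => //; [lia | apply: IHn; lia].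
have [?|?] := leqP (s + 24) (N + 6 * (n + 7)).
  by apply: (D (6 * (n + 7) - 18)); [lia | apply: IHn; lia | apply: IHn; lia].
(* With q = n + 7, only the five sizes from N + 6q - 23 to N + 6q - 19 remain; the other half then
   has size 6q - 17 to 6q - 13. *)
by apply: (D (N - 6)); [lia | apply: IHn; lia | apply: IHn; lia].
Qed.

Lemma realizable_quadratic (p s : nat) : 7 <= p -> p ^ 2 + 3 * p <= 2 * s + 30 ->
  s + 6 <= 2 ^ p -> realizable p s.
Proof.
move=> p7 lo hi; have [?|small] := leqP (6 * p) (s + 18).
  exact: realizable_range.
have r5 := realizable_shift 5 isT.
have r6 a : 6 + a = s - 8 -> realizable 5 a -> realizable 6 (s - 8).
  by move=> <- ra; apply: realizableD.
have r7 : p = 7 -> realizable p s.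
  move=> p_7; rewrite p_7 in lo small *; have ? : 20 <= s < 24 by lia.
  rewrite -(@subnKC 8 s); last by lia.
  apply: realizableD; first exact: realizable6_8.
  (* Beside the 8, the six remaining qubits must supply 12 = 6 + 6, 13, 14 = 6 + 8 or 15 = 6 + 9. *)
  have [e|?] := eqVneq s 20; first by apply: (r6 6); rewrite ?e.
  have [->|?] := eqVneq s 21; first exact: realizable6_13.
  have [e|?] := eqVneq s 22; first by apply: (r6 8); rewrite ?e //; apply: realizable5_8.
  by apply: (r6 9); [lia | apply: realizable5_9].
have [/r7//|?] := eqVneq p 7.
have [p8|?] := eqVneq p 8; last by nia.
have -> : s = 8 + 21 by lia.
rewrite p8; apply: realizableD; first exact: (realizable_shift 7).
by apply: (realizableD 6 8 13); [apply: realizable6_8 | apply: realizable6_13].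
Qed.

Local Open Scope ring_scope.

(** * From words to product vectors *)

Definition dot (C : numClosedFieldType) (v w : 'I_2 -> C) : C :=
  \sum_(x < 2) (v x)^* * w x.

Lemma inner_tensor (C : numClosedFieldType) (p : nat) (v w : 'I_p -> 'I_2 -> C) :
  inner (tensor v) (tensor w) = \prod_(j < p) dot C (v j) (w j).
Proof.
rewrite /dot bigA_distr_bigA /inner; apply: eq_bigr => x _.
by rewrite !ffunE rmorph_prod -big_split.
Qed.

(* The bases are spanned by (1, t) and (- t, 1), for t in nat. *)
Definition symbol_vec (C : numClosedFieldType) (a : nat) (x : 'I_2) : C :=
  let t := a./2%:R in
  (sqrtC (1 + t ^+ 2))^-1 *
    (if odd a then if x == 0 then - t else 1 else if x == 0 then 1 else t).

Lemma symbol_norm_gt0 (C : numClosedFieldType) (n : nat) :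
  0 < 1 + (n%:R : C) ^+ 2.
Proof. by rewrite -natrX addrC natr1 ltr0n. Qed.

Lemma dot_symbol (C : numClosedFieldType) (a : nat) (w : 'I_2 -> C) :
  dot C (symbol_vec C a) w = (sqrtC (1 + a./2%:R ^+ 2))^-1 *
    (if odd a then w 1 - a./2%:R * w 0 else w 0 + a./2%:R * w 1).
Proof.
have s0 : (sqrtC (1 + (a./2%:R : C) ^+ 2))^-1 \is Num.real.
  by rewrite ger0_real // invr_ge0 sqrtC_ge0 ltW ?symbol_norm_gt0.
rewrite /dot 2!big_ord_recl big_ord0 addr0 /symbol_vec /=.
rewrite (_ : lift _ _ = 1); last exact/val_inj.
rewrite !rmorphM /= !(CrealP s0).
by case: odd; rewrite ?rmorphN ?rmorph1 ?rmorph_nat; ring.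
Qed.

Lemma dot_symbol_eq0 (C : numClosedFieldType) (a : nat) (w : 'I_2 -> C) :
  (dot C (symbol_vec C a) w == 0) =
  ((if odd a then w 1 - a./2%:R * w 0 else w 0 + a./2%:R * w 1) == 0).
Proof.
by rewrite dot_symbol mulf_eq0 invr_eq0 sqrtC_eq0 gt_eqF ?symbol_norm_gt0.
Qed.

Lemma dot_symbol_same (C : numClosedFieldType) (a : nat) :
  dot C (symbol_vec C a) (symbol_vec C a) = 1.
Proof.
have := symbol_norm_gt0 C a./2; rewrite dot_symbol /symbol_vec /=.
set t : C := a./2%:R => t0; set r := sqrtC _.
have r2 : r ^+ 2 = 1 + t ^+ 2 by rewrite sqrtCK.
have r0 : r != 0 by rewrite sqrtC_eq0 gt_eqF.
transitivity (r^-1 ^+ 2 * (1 + t ^+ 2)); first by case: odd; ring.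
by rewrite -r2 -exprMn mulVf // expr1n.
Qed.

Lemma dot_symbol_clash (C : numClosedFieldType) (a b : nat) :
  clash a b -> dot C (symbol_vec C a) (symbol_vec C b) = 0.
Proof.
case/andP=> /eqP hab nab; apply/eqP; rewrite dot_symbol_eq0 /symbol_vec /= hab.
have -> : odd b = ~~ odd a by lia.
by apply/eqP; case: odd => /=; ring.
Qed.

(** Orthogonality to a symbol fixes the ratio of the coordinates of [w]. Equal parities give equal
    parameters; opposite ones would give (1 + mn) w 0 = 0 with m, n natural, hence [w] = 0. *)
Lemma dot_symbol_inj (C : numClosedFieldType) (a b : nat) (w : 'I_2 -> C) :
  (w 0 != 0) || (w 1 != 0) -> dot C (symbol_vec C a) w = 0 ->
  dot C (symbol_vec C b) w = 0 -> a = b.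
Proof.
move=> w0 /eqP + /eqP; rewrite !dot_symbol_eq0 => Ha Hb.
have same (n m : nat) (u v : C) : (u != 0) || (v != 0) ->
    u + n%:R * v = 0 -> u + m%:R * v = 0 -> n = m.
  move=> uv un um; have : (n%:R - m%:R) * v = 0.
      by rewrite -[RHS](subrr 0) -{1}un -um; ring.
  move/eqP; rewrite mulf_eq0 subr_eq0 eqr_nat => /orP[/eqP//|/eqP v0].
  by move: un uv; rewrite v0 mulr0 addr0 => ->; rewrite eqxx.
have mixed (n m : nat) : w 1 - n%:R * w 0 = 0 -> w 0 + m%:R * w 1 = 0 -> False.
  move=> /eqP; rewrite subr_eq0 => /eqP e1 e0; move: w0; rewrite e1.
  have : (1 + m%:R * n%:R) * w 0 = 0 by rewrite -e0 e1; ring.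
  rewrite -natrM addrC natr1 => /eqP; rewrite mulf_eq0 pnatr_eq0 /= => /eqP->.
  by rewrite mulr0 eqxx.
suff [ho hh] : odd a = odd b /\ a./2 = b./2 by lia.
case: odd Ha => /eqP Ha; case: odd Hb => /eqP Hb.
- split=> //; apply: (same _ _ (w 1) (- w 0)); rewrite ?oppr_eq0 1?orbC ?mulrN //.
- by case: (mixed _ _ Ha Hb).
- by case: (mixed _ _ Hb Ha).
- by split=> //; apply: (same _ _ (w 0) (w 1)).
Qed.

Definition row_vec (C : numClosedFieldType) (p : nat) (r : seq nat) : qvec C p :=
  tensor (fun j : 'I_p => symbol_vec C (nth 0%N r j)).

Lemma inner_row_same (C : numClosedFieldType) (p : nat) (r : seq nat) :
  inner (row_vec C p r) (row_vec C p r) = 1.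
Proof. by rewrite inner_tensor big1 // => j _; apply: dot_symbol_same. Qed.

Lemma inner_row_clash (C : numClosedFieldType) (p : nat) (r t : seq nat) :
  size r = p -> size t = p -> somewhere clash r t ->
  inner (row_vec C p r) (row_vec C p t) = 0.
Proof.
move=> sr st /(somewhereP _ _ _ _ sr st)[j jp cl]; rewrite inner_tensor.
by apply/eqP/prodf_eq0; exists (Ordinal jp) => //=; rewrite dot_symbol_clash.
Qed.

Lemma code_UPB (C : numClosedFieldType) (p : nat) (S : seq (seq nat)) :
  is_code p S -> is_UPB [seq row_vec C p r | r <- S].
Proof.
move=> codeS; have szS r : r \in S -> size r = p.
  by case: codeS => /allP h _ _ /h/eqP.
have orth r t : r \in S -> t \in S -> r != t ->
    inner (row_vec C p r) (row_vec C p t) = 0.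
  move=> rS tS rt; apply: inner_row_clash; rewrite ?szS //.
  exact: code_clash codeS rS tS rt.
split.
(* If distinct rows had the same vector, its inner square would be both 0 and 1. *)
- rewrite map_inj_in_uniq ?(code_uniq _ _ codeS) // => r t rS tS ert.
  apply/eqP/negPn/negP => /(orth _ _ rS tS)/eqP.
  by rewrite -ert inner_row_same oner_eq0.
- move=> _ /mapP[r _ ->]; split; last exact: inner_row_same.
  by exists (fun j : 'I_p => symbol_vec C (nth 0%N r j)).
- move=> _ _ /mapP[r rS ->] /mapP[t tS ->] nrt; apply: orth => //.
  by apply: contraNneq nrt => ->.
move=> w [v ->] w0 _ ow.
have v0 (j : 'I_p) : (v j 0 != 0) || (v j 1 != 0).
  apply: contraNT w0; rewrite negb_or !negbK => /andP[/eqP v00 /eqP v01].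
  apply/eqP/ffunP=> x; rewrite !ffunE (bigD1 j) //=.
  have [->|->] : x j = 0 \/ x j = 1.
    by case: (x j) => -[|[|//]] ?; [left | right]; apply: val_inj.
  - by rewrite v00 mul0r.
  - by rewrite v01 mul0r.
(* z j is a symbol of column j orthogonal to v j, if there is one. *)
pose kills (j : 'I_p) a := dot C (symbol_vec C a) (v j) == 0.
pose z := [tuple
  head 0%N [seq a <- [seq nth 0%N r j | r : seq nat <- S] | kills j a] | j < p].
(* Some row [r] avoids [z], yet orthogonality to [w] makes a factor vanish in some column [j]. The
   filtered list is then nonempty, so its head is not the default 0, and it must equal the entry of
   [r]. *)
have [_ _ /(_ z (size_tuple z))[r rS /negP[]]] := codeS.
have /eqP := ow _ (map_f _ rS); rewrite inner_tensor => /prodf_eq0[j _ kj].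
apply/(somewhereP _ _ _ _ (size_tuple z) (szS r rS)); exists (nat_of_ord j) => //.
rewrite -(tnth_nth 0%N z) tnth_mktuple; apply/eqP.
set s := filter _ _; have rs : nth 0%N r j \in s.
  by rewrite mem_filter /kills kj /=; apply: map_f.
apply: (dot_symbol_inj C _ _ (v j) (v0 j)); apply/eqP => //.
have : head 0%N s \in s by case: s rs => // a s _; apply: mem_head.
by rewrite mem_filter => /andP[].
Qed.

Local Close Scope ring_scope.

(* (p^2+3p-30)/2 <= s  is written as  p^2 + 3p <= 2s + 30  (exact over nat);
   s <= 2^p - 6  is written as  s + 6 <= 2^p. *)
Theorem theorem1 (C : numClosedFieldType) (p : nat) (hp : 7 <= p) (s : nat)
  (hlo : p ^ 2 + 3 * p <= 2 * s + 30) (hhi : s + 6 <= 2 ^ p) :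
  exists S : seq (qvec C p), is_UPB S /\ size S = s.
Proof.
have [S [codeS sS]] := realizable_quadratic p s hp hlo hhi.
exists [seq row_vec C p r | r <- S]; split; first exact: code_UPB.
by rewrite size_map.
Qed.
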